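(* Let $a,b:[0,\infty)\to\mathbb{R}$ be Lebesgue measurable and essentially bounded, with $a(t)\ge\alpha>0$ for some constant $\alpha$ and $b(t)\ge 0$. Suppose there exist $A>0$, $B>0$ such that $$\|a-A\|\,\left\|\frac{b}{a}\right\|+\|b-B\|<\begin{cases}B, & A^2\ge 4B,\\[1mm] \dfrac{A\sqrt{4B-A^2}}{4}, & A^2<4B,\end{cases}$$ where $\|\cdot\|$ is the norm in $L_\infty[t_0,\infty)$ for some $t_0\ge 0$. Then the equation $\ddot x(t)+a(t)\dot x(t)+b(t)x(t)=0$ is exponentially stable.
   Context: Inequalities between coefficients are understood almost everywhere. The fundamental function $X(t,s)$: for each fixed $s\ge 0$, $X(\cdot,s)$ is the solution (with locally absolutely continuous derivative, equation satisfied almost everywhere) of $\ddot x+a\dot x+bx=0$ on $t\ge s$ with $x(s)=0$, $\dot x(s)=1$. The equation is called exponentially stable if there exist $K>0,\lambda>0$ such that $|X(t,s)|\le K e^{-\lambda(t-s)}$ for all $t\ge s\ge 0$. *)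

(* Defs.v *)
From HB Require Import structures.
From mathcomp Require Import all_boot all_order all_algebra.
From mathcomp Require Import all_classical all_reals all_analysis.
Set Implicit Arguments.
Unset Strict Implicit.
Unset Printing Implicit Defensive.
Import Order.TTheory GRing.Theory Num.Theory.
Import numFieldNormedType.Exports.
Local Open Scope classical_set_scope.
Local Open Scope ring_scope.

(* Functions on [s, +oo[ are represented by total functions R -> R; every
   predicate below only depends on their values on the relevant half-line. *)

(* [measurableTypeR R] carries the Borel sigma-algebra. Lebesgue measurability
   of the domain is that of the domain of [completed_lebesgue_measure], i.e.
   Caratheodory measurability for the Lebesgue outer measure. *)
Definition lebesgue_measurable_fun (R : realType) (D : set R) (f : R -> R) :=
  @measurable_fun _ _ (caratheodory_type (wlength (@idfun R))^*%mu)
    (measurableTypeR R) D f.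

(* The L_oo(D) norm; extending by 0 outside of D leaves the essential supremum
   of `|f| over D unchanged as soon as D has positive measure. *)
Definition Linf_norm (R : realType) (D : set R) (f : R -> R) : \bar R :=
  'N[@lebesgue_measure R]_(+oo%E)[EFin \o (f \_ D)]%E.

(* Derivative relative to D: one-sided at an endpoint of an interval D. *)
Definition has_derivative_within (R : realType) (D : set R) (f : R -> R)
    (t l : R) :=
  (fun u => (f u - f t) / (u - t)) @ within D t^' --> l.

Definition abs_continuous_on (R : realType) (c d : R) (f : R -> R) :=
  forall e : R, 0 < e -> exists2 delta : R, 0 < delta &
  forall (n : nat) (u v : 'I_n -> R),
    (forall i, c <= u i /\ u i <= v i /\ v i <= d) ->
    trivIset [set: 'I_n] (fun i => `]u i, v i[%classic) ->
    \sum_(i < n) (v i - u i) < delta ->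
    \sum_(i < n) `|f (v i) - f (u i)| < e.

Definition loc_abs_continuous_from (R : realType) (s : R) (f : R -> R) :=
  forall T : R, s <= T -> abs_continuous_on s T f.

(* x solves x'' + a x' + b x = 0 on [s, +oo[ and dx is its derivative. *)
Definition is_solution (R : realType) (a b : R -> R) (s : R) (x dx : R -> R) :=
  [/\ forall t, s <= t -> has_derivative_within `[s, +oo[ x t (dx t),
      loc_abs_continuous_from s dx &
      {ae (@lebesgue_measure R), forall t, s < t ->
        derivable dx t 1 /\ 'D_1 dx t + a t * dx t + b t * x t = 0}].

Definition is_fundamental_function (R : realType) (a b : R -> R)
    (X : R -> R -> R) :=
  forall s, 0 <= s -> exists dx : R -> R,
    [/\ is_solution a b s (fun t => X t s) dx, X s s = 0 & dx s = 1].

(* For locally integrable coefficients the fundamental function exists and its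
   values X t s with 0 <= s <= t are unique (Caratheodory), so quantifying over
   all X satisfying its defining property amounts to speaking about it. *)
Definition exponentially_stable (R : realType) (a b : R -> R) :=
  forall X : R -> R -> R, is_fundamental_function a b X ->
  exists K lambda : R, [/\ 0 < K, 0 < lambda &
    forall t s, 0 <= s -> s <= t -> `|X t s| <= K * expR (- lambda * (t - s))].

(* Main.v *)
(** Write the equation as [x'' + A x' + B x = (A - a) x' + (B - b) x] and weight
    [x], [x'] by [e^{l(t-c)}] with a small rate [l], giving [u] and [v]. Since
    [v' = - (a - l) v - b u], the maximum principle bounds [|v|] by
    [|v(c)| + ||b/(a-l)|| sup |u|], so the right-hand side is at most a constant
    plus (almost) [(||a-A|| ||b/a|| + ||b-B||) sup |u|]. The constant-coefficient
    equation maps a right-hand side bounded by [F] to a solution bounded by a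
    constant plus (almost) [F] divided by the threshold: factor it into two
    first-order equations when [A^2 >= 4B], and use the energy
    [(v + A/2 u)^2 + (B - A^2/4) u^2] otherwise. Hence [sup |u|] is bounded by
    [K (|u(c)| + |v(c)|)] with [K] independent of [c] and of the horizon.

    No integral occurs: every bound is a maximum principle for absolutely
    continuous functions, which rests on the fact that such a function with
    a.e. nonpositive derivative is nonincreasing. *)

Require Import Defs.
From mathcomp Require Import all_boot all_order all_algebra.
From mathcomp Require Import all_classical all_reals all_analysis.
From mathcomp Require Import lra ring.
Set Implicit Arguments.
Unset Strict Implicit.
Unset Printing Implicit Defensive.
Import Order.TTheory GRing.Theory Num.Theory.
Import numFieldNormedType.Exports.
Local Open Scope classical_set_scope.
Local Open Scope ring_scope.

(* The hints of the library do not see the filter through the type on which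
   [lebesgue_measure] is declared. *)
#[export] Instance lebesgue_ae_filter (R : realType) :
  Filter (nbhs (almost_everywhere (@lebesgue_measure R))).
Proof. exact: (ae_filter_ringOfSetsType (@lebesgue_measure R)). Qed.

(** * Monotonicity of absolutely continuous functions *)

(** Let [S] be the set of [t] with [P c t]. A local piece around [sup S], glued to some [P c t] with
    [t] close to [sup S], would lead past the supremum unless it reaches [d]. This compactness
    principle turns local estimates at each point into estimates on the whole interval. *)
Lemma cousin (R : realType) (P : R -> R -> Prop) (c d : R) : c <= d ->
  (forall p q r, c <= p -> p <= q -> q <= r -> r <= d ->
     P p q -> P q r -> P p r) ->
  (forall t, c <= t -> t <= d -> exists2 e, 0 < e &
     forall p q, c <= p -> p <= t -> t <= q -> q <= d ->
       t - e < p -> q < t + e -> P p q) ->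
  P c d.
Proof.
move=> cd Padd Ploc.
pose S := [set t | c <= t /\ t <= d /\ P c t].
have Sc : S c.
  have [e e0 He] := Ploc c (lexx c) cd.
  by split => //; split => //; apply: He; rewrite ?lexx//; lra.
have Sub : has_ubound S by exists d => t [_ [] ].
have Ssup : has_sup S by split; first by exists c.
have cs : c <= sup S by apply: ub_le_sup.
have sd : sup S <= d by apply: ge_sup; [exists c|move=> t [_ []]].
have [e e0 He] := Ploc _ cs sd.
have [t [ct [td Pt]] ht] := sup_adherent e0 Ssup.
have ts : t <= sup S by apply: ub_le_sup.
have [h|h] := ltP d (sup S + e / 2).
  apply: (Padd _ t) => //; apply: He => //; lra.
have : S (sup S + e / 2).
  split; first lra.
  split => //; apply: (Padd _ t) => //; first lra.
  apply: He => //; lra.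
by move=> /(ub_le_sup Sub); lra.
Qed.

Lemma is_derive_remainder (R : realType) (g : R -> R) (t l e : R) :
  is_derive t 1 g l -> 0 < e -> exists2 r, 0 < r &
  forall u, `|u - t| < r -> `|g u - g t - l * (u - t)| <= e * `|u - t|.
Proof.
move=> [dg gl] e0; move: dg; rewrite /derivable => /cvg_ex[l' hl].
have El : l = l' by rewrite -gl /derive; apply: cvg_lim.
move: hl; rewrite -El => /cvgrPdist_le /(_ e e0).
rewrite near_withinE near_simpl => -[r /= r0 Hr].
exists r => // u ut; have [->|nut] := eqVneq u t.
  by rewrite !subrr mulr0 subrr normr0 mulr0.
have := Hr (u - t); rewrite /ball_ /= sub0r normrN => /(_ ut).
rewrite subr_eq0 => /(_ nut); rewrite /GRing.scale /= mulr1 subrK => H.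
have n0 : 0 < `|u - t| by rewrite normr_gt0 subr_eq0.
have -> : g u - g t - l * (u - t) = - ((l - (u - t)^-1 * (g u - g t)) * (u - t)).
  by field; rewrite subr_eq0.
by rewrite normrN normrM ler_pM2r.
Qed.

Lemma open_interval_around (R : realType) (U : set R) (t : R) :
  open U -> U t -> exists2 r, 0 < r &
  forall p q, t - r < p -> q < t + r -> `]p, q[%classic `<=` U.
Proof.
move=> oU Ut; have : nbhs t U by exact: open_nbhs_nbhs.
move=> [r /= r0 H]; exists r => // p q hp hq u /=.
rewrite in_itv /= => /andP[pu uq]; apply: H => /=.
by rewrite ltr_norml; apply/andP; split; lra.
Qed.

(** Ordered intervals inside [U] have disjoint interiors, so their total length is at most the
    measure of [U], and absolute continuity applies to them. *)
Lemma ac_sum_small (R : realType) (c d e : R) (g : R -> R) :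
  abs_continuous_on c d g -> 0 < e -> exists2 delta : R, 0 < delta &
  forall (U : set R) (s : seq (R * R)), open U ->
    (lebesgue_measure U < delta%:E)%E ->
    (forall z, z \in s -> [/\ c <= z.1, z.1 <= z.2, z.2 <= d &
       `]z.1, z.2[%classic `<=` U]) ->
    pairwise (fun z w => z.2 <= w.1) s ->
    \sum_(z <- s) (g z.2 - g z.1) < e.
Proof.
move=> acg e0; have [delta delta0 H] := acg e e0.
exists delta => // U s oU mU sU spw.
pose u (i : 'I_(size s)) := (nth (0, 0) s i).1.
pose v (i : 'I_(size s)) := (nth (0, 0) s i).2.
have uv i : [/\ c <= u i, u i <= v i, v i <= d & `]u i, v i[%classic `<=` U].
  by apply: sU; apply: mem_nth.
have triv : trivIset [set: 'I_(size s)] (fun i => `]u i, v i[%classic).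
  apply/trivIsetP => i j _ _.
  wlog ij : i j / (i < j)%N.
    move=> W; rewrite neq_lt => /orP[] h; first by apply: W => //; rewrite lt_eqF.
    by rewrite setIC; apply: W => //; rewrite lt_eqF.
  move=> _; apply/seteqP; split => // w [] /=; rewrite !in_itv /= => /andP[_ h1] /andP[h2 _].
  have /(pairwiseP (0, 0)) /(_ i j) := spw.
  rewrite !inE => /(_ (ltn_ord i) (ltn_ord j) ij); rewrite -/(u j) -/(v i).
  lra.
have mitv i : measurable (`]u i, v i[%classic : set (measurableTypeR R)) by exact: measurable_itv.
have len : \sum_(i < size s) (v i - u i) < delta.
  rewrite -lte_fin; apply: le_lt_trans mU.
  have -> : (\sum_(i < size s) (v i - u i))%:E =
      (\sum_(i < size s) lebesgue_measure (`]u i, v i[%classic : set R))%E.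
    rewrite -sumEFin; apply: eq_bigr => i _.
    rewrite lebesgue_measure_itv /= lte_fin; case: ltP => // h.
    by have [_ h' _ _] := uv i; have -> : v i = u i by [apply/eqP; rewrite eq_le h h'] ; rewrite subrr.
  rewrite -measure_bigsetU_ord //.
  apply: le_measure; rewrite ?inE.
  - by apply: bigsetU_measurable => i _; exact: mitv.
  - exact: measurable_realfun.open_measurable.
  - by apply: (big_ind (fun A => A `<=` U)) => // [A B|i _]; [rewrite subUset|case: (uv i)].
have := H _ u v _ triv len.
have Huv i : c <= u i /\ u i <= v i /\ v i <= d by have [] := uv i.
move=> /(_ Huv); apply: le_lt_trans.
rewrite (big_nth (0, 0)) big_mkord.
by apply: ler_sum => i _; exact: ler_norm.
Qed.

(** Outer regularity, applied to the null set enlarged by [c] and [d]: derivatives will be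
    controlled only inside []c, d[], so the endpoints count as exceptional points. *)
Lemma negligible_open_cover (R : realType) (N : set R) (delta : R) :
  (@lebesgue_measure R).-negligible N -> forall c d, 0 < delta ->
  exists U : set R, [/\ open U, N `<=` U, U c, U d &
    (lebesgue_measure U < delta%:E)%E].
Proof.
move=> [A [mA A0 NA]] c d delta0.
pose A' : set (measurableTypeR R) := A `|` [set c] `|` [set d].
have mA' : measurable A' by apply: measurableU; [apply: measurableU|].
have A'0 : (lebesgue_measure A' = 0)%E.
  rewrite /A' !measureU0//; [exact: lebesgue_measure_set1| |exact: lebesgue_measure_set1].
  exact: measurableU.
have fA' : (lebesgue_measure A' < +oo)%E by rewrite A'0 ltry.
have [U [oU AU UA]] := lebesgue_regularity_outer mA' fA' delta0.
exists U; split => //.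
- by move=> x /NA Ax; apply: AU; left; left.
- by apply: AU; left; right.
- by apply: AU; right.
- rewrite -(setDUK AU); apply: le_lt_trans UA.
  rewrite -[leRHS]add0e -A'0.
  apply: measureU2 => //.
  by apply: measurableD => //; exact: measurable_realfun.open_measurable.
Qed.

(** Cover the exceptional points by an open [U] of small measure. Around a point of [U] the
    increment of [g] is recorded in a list of intervals inside [U]; around any other point it is at
    most [e] times the length. Gluing these pieces keeps the list ordered, and absolute continuity
    makes its total contribution less than [e]. *)
Lemma ac_ae_nonincreasing (R : realType) (g : R -> R) (c d : R) : c <= d ->
  abs_continuous_on c d g ->
  {ae (@lebesgue_measure R), forall t, c < t -> t < d ->
     exists2 l, is_derive t (1 : R) g l & l <= 0} ->
  g d <= g c.
Proof.
move=> cd acg aeg; apply/ler_addgt0Pr => e' e'0.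
(* The errors [e * (d - c)] from the differentiable points and [e] from [U] then add up to [e']. *)
pose e := e' / (d - c + 1).
have e0 : 0 < e by rewrite divr_gt0//; lra.
suff : g d - g c <= e * (d - c) + e.
  have -> : e * (d - c) + e = e' by rewrite /e; field; lra.
  lra.
have [delta delta0 Hdelta] := ac_sum_small acg e0.
have [U [oU NU Uc Ud mU]] := negligible_open_cover aeg c d delta0.
pose ok (p q : R) (z : R * R) :=
  [/\ p <= z.1, z.1 <= z.2, z.2 <= q & `]z.1, z.2[%classic `<=` U].
pose P p q := exists s : seq (R * R),
  [/\ forall z, z \in s -> ok p q z, pairwise (fun z w => z.2 <= w.1) s &
   g q - g p <= e * (q - p) + \sum_(z <- s) (g z.2 - g z.1)].
suff [s [sok spw sle]] : P c d.
  apply: (le_trans sle); rewrite lerD2l ltW//.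
  exact: (Hdelta U s oU mU sok spw).
apply: cousin => //.
- move=> p q r cp pq qr rd [s [sok spw sle]] [s' [sok' spw' sle']].
  exists (s ++ s'); split.
  + move=> z; rewrite mem_cat => /orP[/sok|/sok'] [h1 h2 h3 h4]; split => //; lra.
  + rewrite pairwise_cat spw spw' !andbT; apply/allrelP => z w /sok[_ _ h _] /sok'[h' _ _ _].
    lra.
  + rewrite big_cat /=; lra.
- move=> t ct td; have [Ut|nUt] := pselect (U t).
  + have [r r0 Hr] := open_interval_around oU Ut.
    exists r => // p q cp pt tq qd h1 h2.
    exists [:: (p, q)]; split => //.
    * by move=> z; rewrite inE => /eqP ->; split => //=; [lra|exact: Hr].
    * rewrite big_seq1 /= lerDr mulr_ge0//; lra.
  + have ct' : c < t by rewrite lt_neqAle ct andbT; apply/eqP => h; rewrite -h in nUt.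
    have td' : t < d by rewrite lt_neqAle td andbT; apply/eqP => h; rewrite h in nUt.
    have [l gl l0] : exists2 l, is_derive t (1 : R) g l & l <= 0.
      by apply: contrapT => h; apply: nUt; apply: NU => /= /(_ ct' td').
    (* As [t] lies between [p] and [q], the expansions at [t] towards both ends combine: the errors
       sum to [e * (q - p)], and the linear terms have the right sign because [l <= 0]. *)
    have [r r0 Hr] := is_derive_remainder gl e0.
    exists r => // p q cp pt tq qd h1 h2; exists [::]; split => //.
    rewrite big_nil addr0.
    have : `|p - t| < r by rewrite ler0_norm; lra.
    move=> /Hr; rewrite [X in _ <= e * X]ler0_norm ?ler_norml; last lra.
    move=> /andP[h3 _].
    have : `|q - t| < r by rewrite ger0_norm; lra.
    move=> /Hr; rewrite [X in _ <= e * X]ger0_norm ?ler_norml; last lra.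
    move=> /andP[_ h4].
    have : l * (q - t) <= 0 by rewrite mulr_le0_ge0//; lra.
    have : 0 <= l * (p - t) by rewrite mulr_le0//; lra.
    lra.
Qed.

(** * Closure properties of absolute continuity *)

Section AbsoluteContinuity.
Variables (R : realType) (c d : R).
Implicit Types f g : R -> R.

Lemma ac_unif_continuous g : abs_continuous_on c d g ->
  forall e, 0 < e -> exists2 r, 0 < r &
  forall u v, c <= u -> u <= v -> v <= d -> v - u < r -> `|g v - g u| < e.
Proof.
move=> acg e e0; have [r r0 H] := acg e e0; exists r => // u v cu uv vd uvr.
have := H 1%N (fun=> u) (fun=> v); rewrite !big_ord1; apply => //.
by apply/trivIsetP => i j _ _; rewrite !ord1.
Qed.

Lemma ac_bounded g : c <= d -> abs_continuous_on c d g ->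
  exists2 M, 0 <= M & forall t, c <= t -> t <= d -> `|g t| <= M.
Proof.
move=> cd acg; have [r r0 H] := ac_unif_continuous acg ltr01.
apply: (cousin (P := fun p q => exists2 M, 0 <= M &
  forall t, p <= t -> t <= q -> `|g t| <= M)) => //.
- move=> p q s cp pq qs sd [M M0 HM] [M' M'0 HM'].
  exists (M + M'); first lra.
  move=> t pt ts; have [tq|qt] := leP t q; first by have := HM t pt tq; lra.
  by have := HM' t (ltW qt) ts; lra.
- move=> t ct td; exists r => // p q cp pt tq qd h1 h2.
  exists (`|g t| + 1) => [|u pu uq]; first by have := normr_ge0 (g t); lra.
  have [ut|tu] := leP u t.
    have ur : t - u < r by lra.
    have := H u t (le_trans cp pu) ut td ur; rewrite distrC.
    have := lerB_dist (g u) (g t); lra.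
  have ur : u - t < r by lra.
  have := H t u ct (ltW tu) (le_trans uq qd) ur.
  have := lerB_dist (g u) (g t); lra.
Qed.

Lemma acD f g : abs_continuous_on c d f -> abs_continuous_on c d g ->
  abs_continuous_on c d (fun t => f t + g t).
Proof.
move=> acf acg e e0; have e20 : 0 < e / 2 by lra.
have [r r0 H] := acf _ e20; have [r' r'0 H'] := acg _ e20.
exists (Num.min r r'); first by rewrite lt_min r0.
move=> n u v uv tr; rewrite lt_min => /andP[h h'].
have := H n u v uv tr h; have := H' n u v uv tr h'.
suff : \sum_(i < n) `|f (v i) + g (v i) - (f (u i) + g (u i))| <=
    \sum_(i < n) `|f (v i) - f (u i)| + \sum_(i < n) `|g (v i) - g (u i)| by lra.
rewrite -big_split /=; apply: ler_sum => i _.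
by rewrite opprD addrACA ler_normD.
Qed.

Lemma acM f g : c <= d -> abs_continuous_on c d f -> abs_continuous_on c d g ->
  abs_continuous_on c d (fun t => f t * g t).
Proof.
move=> cd acf acg e e0.
have [Mf Mf0 Hf] := ac_bounded cd acf; have [Mg Mg0 Hg] := ac_bounded cd acg.
have ef : 0 < e / 2 / (Mg + 1) by rewrite divr_gt0//; lra.
have eg : 0 < e / 2 / (Mf + 1) by rewrite divr_gt0//; lra.
have [r r0 H] := acf _ ef; have [r' r'0 H'] := acg _ eg.
exists (Num.min r r'); first by rewrite lt_min r0.
move=> n u v uv tr; rewrite lt_min => /andP[h h'].
have := H n u v uv tr h; have := H' n u v uv tr h'.
rewrite !ltr_pdivlMr; [|lra..].
suff : \sum_(i < n) `|f (v i) * g (v i) - f (u i) * g (u i)| <=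
    (\sum_(i < n) `|f (v i) - f (u i)|) * (Mg + 1) +
    (\sum_(i < n) `|g (v i) - g (u i)|) * (Mf + 1) by lra.
rewrite !mulr_suml -big_split /=; apply: ler_sum => i _.
have -> : f (v i) * g (v i) - f (u i) * g (u i) =
  (f (v i) - f (u i)) * g (v i) + (g (v i) - g (u i)) * f (u i) by ring.
have [cu [uvi vd]] := uv i.
apply: (le_trans (ler_normD _ _)); rewrite !normrM; apply: lerD.
  by apply: ler_wpM2l => //; have := Hg (v i) (le_trans cu uvi) vd; lra.
by apply: ler_wpM2l => //; have := Hf (u i) cu (le_trans uvi vd); lra.
Qed.

Lemma ac_lipschitz (L : R) g :
  (forall u v, c <= u -> u <= v -> v <= d -> `|g v - g u| <= L * (v - u)) ->
  abs_continuous_on c d g.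
Proof.
move=> H e e0; have L0 : 0 < `|L| + 1 by rewrite ltr_wpDl.
exists (e / (`|L| + 1)); first exact: divr_gt0.
move=> n u v uv _; rewrite ltr_pdivlMr//; apply: le_lt_trans.
rewrite mulr_suml; apply: ler_sum => i _.
have [cu [uvi vd]] := uv i; apply: (le_trans (H _ _ cu uvi vd)).
by rewrite mulrC ler_wpM2l ?subr_ge0// (le_trans (ler_norm _))// lerDl.
Qed.

Lemma ac_cst (k : R) : abs_continuous_on c d (fun=> k).
Proof. by apply: (@ac_lipschitz 0) => u v *; rewrite subrr normr0 mul0r. Qed.

Lemma acZ (k : R) g : c <= d -> abs_continuous_on c d g ->
  abs_continuous_on c d (fun t => k * g t).
Proof. by move=> cd acg; apply: acM => //; exact: ac_cst. Qed.

End AbsoluteContinuity.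

Lemma acW (R : realType) (c d c' d' : R) (g : R -> R) :
  c <= c' -> d' <= d -> abs_continuous_on c d g -> abs_continuous_on c' d' g.
Proof.
move=> cc dd acg e e0; have [r r0 H] := acg e e0; exists r => // n u v uv.
apply: H => i; have [h1 [h2 h3]] := uv i.
by split; [exact: le_trans h1|split => //; exact: le_trans dd].
Qed.

(** * A maximum principle and the rules of differentiation *)

(** If [g t > M], let [sup S] be the last point before [t] where [g <= M], a bound that survives
    there by continuity. After it [g > M], so [g] is nonincreasing up to [t], a contradiction. *)
Lemma ac_max_principle (R : realType) (g : R -> R) (c d M : R) :
  abs_continuous_on c d g -> g c <= M ->
  {ae (@lebesgue_measure R), forall t, c < t -> t < d -> M < g t ->
     exists2 l, is_derive t (1 : R) g l & l <= 0} ->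
  forall t, c <= t -> t <= d -> g t <= M.
Proof.
move=> acg gcM aeg t ct td; rewrite leNgt; apply/negP => Mgt.
pose S := [set u | [/\ c <= u, u <= t & g u <= M]].
have Sc : S c by split.
have Sub : has_ubound S by exists t => u [].
have Ssup : has_sup S by split; first by exists c.
have cs : c <= sup S by apply: ub_le_sup.
have st : sup S <= t by apply: ge_sup; [exists c|move=> u []].
have gs : g (sup S) <= M.
  apply/ler_addgt0Pr => e e0.
  have [r r0 H] := ac_unif_continuous acg e0.
  have [u [cu ut guM] hu] := sup_adherent r0 Ssup.
  have us : u <= sup S by apply: ub_le_sup.
  have sur : sup S - u < r by lra.
  have := H u (sup S) cu us (le_trans st td) sur.
  by rewrite ltr_norml => /andP[_]; lra.
have : g t <= g (sup S).
  apply: ac_ae_nonincreasing => //; first exact: acW acg.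
  apply: filterS aeg => u Hu su ut; apply: Hu => //.
  - exact: le_lt_trans su.
  - exact: lt_le_trans td.
  - rewrite ltNge; apply/negP => guM.
    have : S u by split => //; [exact: le_trans (ltW su)|exact: ltW].
    by move=> /(ub_le_sup Sub); lra.
lra.
Qed.

Section DerivativeRules.
Variables (R : realType) (t : R).
Implicit Types f g : R -> R.

Lemma is_derive_fun_add f g (df dg : R) :
  is_derive t (1 : R) f df -> is_derive t (1 : R) g dg ->
  is_derive t (1 : R) (fun x => f x + g x) (df + dg).
Proof. by move=> hf hg; apply: is_deriveD. Qed.

Lemma is_derive_fun_mul f g (df dg : R) :
  is_derive t (1 : R) f df -> is_derive t (1 : R) g dg ->
  is_derive t (1 : R) (fun x => f x * g x) (df * g t + f t * dg).
Proof.
move=> hf hg; have := is_deriveM hf hg.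
by rewrite /GRing.scale /= addrC [g t * df]mulrC.
Qed.

Lemma is_derive_fun_scale (k : R) g (dg : R) : is_derive t (1 : R) g dg ->
  is_derive t (1 : R) (fun x => k * g x) (k * dg).
Proof. by move=> hg; apply: is_deriveZ. Qed.

Lemma is_derive_fun_opp g (dg : R) : is_derive t (1 : R) g dg ->
  is_derive t (1 : R) (fun x => - g x) (- dg).
Proof. by move=> hg; apply: is_deriveN. Qed.

Lemma is_derive_expR_affine (l c : R) :
  is_derive t (1 : R) (fun x => expR (l * (x - c))) (l * expR (l * (t - c))).
Proof.
have h : is_derive t (1 : R) (fun x => l * (x - c)) l.
  rewrite -[X in is_derive _ _ _ X]mulr1; apply: is_derive_fun_scale.
  rewrite -[X in is_derive _ _ _ X]addr0.
  by apply: is_derive_fun_add; exact: is_derive_id || exact: is_derive_cst.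
rewrite mulrC -/(GRing.scale _ _).
exact: (is_derive1_comp (is_derive_expR _) h).
Qed.

End DerivativeRules.

(** * First-order equations, then constant coefficients with a bounded right-hand side *)

(** Where [z > M >= G] the derivative is at most [k (G - z) <= 0]. The coefficient [k] may vary, and
    only a bound on the ratio of [f] to [k] enters; this is how the norm of [b / a] appears. *)
Lemma first_order_upper_bound (R : realType) (z k f : R -> R) (c T G M : R) :
  abs_continuous_on c T z -> z c <= M -> G <= M ->
  {ae (@lebesgue_measure R), forall t, c < t -> t < T ->
    [/\ is_derive t (1 : R) z (- k t * z t + f t), 0 <= k t & f t <= k t * G]} ->
  forall t, c <= t -> t <= T -> z t <= M.
Proof.
move=> acz zc GM ae; apply: ac_max_principle acz zc _.
apply: filterS ae => t H ct tT Mz; have [dz k0 fG] := H ct tT.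
exists (- k t * z t + f t) => //.
have : k t * (G - z t) <= 0 by rewrite mulr_ge0_le0//; lra.
lra.
Qed.

Lemma first_order_bound (R : realType) (z k f : R -> R) (c T G : R) :
  c <= T -> 0 <= G -> abs_continuous_on c T z ->
  {ae (@lebesgue_measure R), forall t, c < t -> t < T ->
    [/\ is_derive t (1 : R) z (- k t * z t + f t), 0 <= k t & `|f t| <= k t * G]} ->
  forall t, c <= t -> t <= T -> `|z t| <= `|z c| + G.
Proof.
move=> cT G0 acz ae t ct tT; rewrite ler_norml lerNl; apply/andP; split.
  apply: (@first_order_upper_bound _ (fun t => - z t) k (fun t => - f t) c T G) => //.
  - rewrite (_ : (fun t => - z t) = (fun t => -1 * z t)).
      exact: acZ.
    by apply/funext => u; rewrite mulN1r.
  - by have := ler_norm (- z c); rewrite normrN; lra.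
  - by have := normr_ge0 (z c); lra.
  - apply: filterS ae => u H cu uT; have [dz k0 fG] := H cu uT; split => //.
      have := is_derive_fun_opp dz; congr (is_derive _ _ _ _); ring.
    by have := ler_norm (- f u); rewrite normrN; lra.
apply: (@first_order_upper_bound _ z k f c T G) => //.
- by have := ler_norm (z c); lra.
- by have := normr_ge0 (z c); lra.
- apply: filterS ae => u H cu uT; have [dz k0 fG] := H cu uT; split => //.
  by have := ler_norm (f u); lra.
Qed.

(* [u] and [v] stand for [e^{l(t-c)} x] and [e^{l(t-c)} x'] where
   [x'' + A x' + B x = e^{-l(t-c)} f]. *)
Definition weighted_system (R : realType) (A B l c T : R) (u v f : R -> R) :=
  [/\ abs_continuous_on c T u, abs_continuous_on c T v &
   {ae (@lebesgue_measure R), forall t, c < t -> t < T ->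
     is_derive t (1 : R) u (l * u t + v t) /\
     is_derive t (1 : R) v (- (A - l) * v t - B * u t + f t)}].

(** The operator factors: [p = v + r1 u] satisfies [p' = - (r2 - l) p + f], and
    [u' = - (r1 - l) u + p]. The first-order bound is applied to [p], then to [u]. *)
Lemma overdamped_bound (R : realType) (r1 r2 l c T F : R) (u v f : R -> R) :
  c <= T -> 0 < r1 -> l < r1 -> l < r2 -> 0 <= F ->
  weighted_system (r1 + r2) (r1 * r2) l c T u v f ->
  {ae (@lebesgue_measure R), forall t, c < t -> t < T -> `|f t| <= F} ->
  forall t, c <= t -> t <= T ->
    `|u t| <= `|u c| + (`|v c| + r1 * `|u c| + F / (r2 - l)) / (r1 - l).
Proof.
move=> cT r10 lr1 lr2 F0 [acu acv aeuv] aef.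
pose p t := v t + r1 * u t.
have acp : abs_continuous_on c T p by apply: acD => //; exact: acZ.
have d1 : 0 < r1 - l by lra.
have d2 : 0 < r2 - l by lra.
have pb : forall t, c <= t -> t <= T -> `|p t| <= `|p c| + F / (r2 - l).
  apply: (@first_order_bound _ p (fun=> r2 - l) f) => //.
    by rewrite divr_ge0// ltW.
  apply: filterS2 aeuv aef => t H Hf ct tT; have [du dv] := H ct tT; split.
  - have := is_derive_fun_add dv (is_derive_fun_scale r1 du).
    by congr (is_derive _ _ _ _); rewrite /p; ring.
  - exact: ltW.
  - by rewrite mulrC divfK ?gt_eqF//; exact: Hf.
have pc : `|p c| <= `|v c| + r1 * `|u c|.
  by rewrite (le_trans (ler_normD _ _))// normrM (gtr0_norm r10).
have G0 : 0 <= (`|v c| + r1 * `|u c| + F / (r2 - l)) / (r1 - l).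
  rewrite divr_ge0 ?(ltW d1)// addr_ge0 ?divr_ge0 ?(ltW d2)// addr_ge0//.
  by rewrite mulr_ge0// ltW.
apply: (@first_order_bound _ u (fun=> r1 - l) p) => //.
apply: filterS aeuv => t H ct tT; have [du dv] := H ct tT; split.
- by move: du; congr (is_derive _ _ _ _); rewrite /p; ring.
- exact: ltW.
- rewrite mulrC divfK ?gt_eqF//.
  by have := pb t (ltW ct) (ltW tT); lra.
Qed.

(* With [z = v + A/2 u], the energy [z^2 + w^2 u^2] has derivative
   [- 2 (A/2 - l) (z^2 + w^2 u^2) + 2 z f]. *)
Lemma underdamped_bound (R : realType) (A w l c T F : R) (u v f : R -> R) :
  c <= T -> 0 < A -> 0 < w -> l < A / 2 -> 0 <= F ->
  weighted_system A (w ^+ 2 + A ^+ 2 / 4) l c T u v f ->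
  {ae (@lebesgue_measure R), forall t, c < t -> t < T -> `|f t| <= F} ->
  forall t, c <= t -> t <= T ->
    w * `|u t| <= `|v c| + (A / 2 + w) * `|u c| + F / (A / 2 - l).
Proof.
move=> cT A0 w0 lA F0 [acu acv aeuv] aef.
pose z t := v t + A / 2 * u t.
pose E t := z t * z t + w ^+ 2 * (u t * u t).
pose Z := `|v c| + (A / 2 + w) * `|u c| + F / (A / 2 - l).
have acz : abs_continuous_on c T z by apply: acD => //; exact: acZ.
have acE : abs_continuous_on c T E.
  by apply: acD; [exact: acM|apply: acZ => //; exact: acM].
have d1 : 0 < A / 2 - l by lra.
have FA0 : 0 <= F / (A / 2 - l) by rewrite divr_ge0// ltW.
have Z0 : 0 <= Z by rewrite /Z !addr_ge0// mulr_ge0//; lra.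
have zc : `|z c| <= `|v c| + A / 2 * `|u c|.
  by rewrite (le_trans (ler_normD _ _))// normrM (gtr0_norm (_ : 0 < A / 2)) //; lra.
have Ec : E c <= Z ^+ 2.
  have -> : E c = `|z c| ^+ 2 + (w * `|u c|) ^+ 2.
    by rewrite exprMn !real_normK ?num_real// /E; ring.
  have wu : 0 <= w * `|u c| by rewrite mulr_ge0// ltW.
  have h : `|z c| + w * `|u c| <= Z by rewrite /Z; lra.
  apply: (@le_trans _ _ ((`|z c| + w * `|u c|) ^+ 2)).
    have : 0 <= `|z c| * (w * `|u c|) by rewrite mulr_ge0.
    rewrite sqrrD; lra.
  by rewrite ler_sqr ?nnegrE// addr_ge0.
have EZ : forall t, c <= t -> t <= T -> E t <= Z ^+ 2.
  apply: ac_max_principle acE Ec _.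
  apply: filterS2 aeuv aef => t H Hf ct tT ZE; have [du dv] := H ct tT.
  have dz := is_derive_fun_add dv (is_derive_fun_scale (A / 2) du).
  have dE := is_derive_fun_add (is_derive_fun_mul dz dz)
    (is_derive_fun_scale (w ^+ 2) (is_derive_fun_mul du du)).
  exists (- 2 * (A / 2 - l) * E t + 2 * z t * f t).
    by move: dE; congr (is_derive _ _ _ _); rewrite /E /z; field.
  have E0 : 0 <= E t by rewrite /E -!expr2 addr_ge0 ?sqr_ge0// mulr_ge0 ?sqr_ge0.
  (* Where the energy exceeds [Z ^+ 2], its root [e] exceeds [F / (A / 2 - l)]. With [|z| <= e] the
     forcing term [2 z f] is then at most [2 (A / 2 - l) e ^+ 2], which the damping cancels. *)
  pose e := Num.sqrt (E t).
  have eE : e ^+ 2 = E t by rewrite sqr_sqrtr.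
  have e0 : 0 <= e by exact: sqrtr_ge0.
  have Ze : Z < e by rewrite -(@ltr_sqr _ Z e) ?nnegrE// eE.
  have ze : `|z t| <= e.
    rewrite -ler_sqr ?nnegrE// eE real_normK ?num_real// /E -expr2 lerDl.
    by rewrite -expr2 mulr_ge0// sqr_ge0.
  have Fe : F <= (A / 2 - l) * e.
    rewrite mulrC -ler_pdivrMr//; apply: le_trans (ltW Ze).
    by rewrite /Z lerDr addr_ge0// mulr_ge0//; lra.
  have : z t * f t <= e * ((A / 2 - l) * e).
    rewrite (le_trans (ler_norm _))// normrM ler_pM//.
    by apply: le_trans Fe; exact: Hf.
  rewrite -eE; lra.
move=> t ct tT; rewrite -/Z -ler_sqr ?nnegrE//; last by rewrite mulr_ge0// ltW.
apply: le_trans (EZ t ct tT); rewrite exprMn real_normK ?num_real// /E -!expr2.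
by rewrite lerDr sqr_ge0.
Qed.

Definition stability_threshold (R : realType) (A B : R) :=
  if 4 * B <= A ^+ 2 then B else A * Num.sqrt (4 * B - A ^+ 2) / 4.

(** The gain [1 / m] from right-hand side to solution is kept apart from the constant [C] on the
    initial values, since only the gain has to compete with the perturbation. Both are uniform in
    [c], [T] and [f]. *)
Definition weighted_bound (R : realType) (A B l C m : R) :=
  forall (c T F : R) (u v f : R -> R), c <= T -> 0 <= F ->
    weighted_system A B l c T u v f ->
    {ae (@lebesgue_measure R), forall t, c < t -> t < T -> `|f t| <= F} ->
    forall t, c <= t -> t <= T -> `|u t| <= C * (`|u c| + `|v c|) + F / m.

Lemma overdamped_weighted_bound (R : realType) (A B m : R) :
  0 < A -> 0 < m -> m < B -> 4 * B <= A ^+ 2 ->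
  exists l0 C, [/\ 0 < l0, 0 <= C &
    forall l, 0 < l -> l <= l0 -> weighted_bound A B l C m].
Proof.
move=> A0 m0 mB BA; have B0 : 0 < B by lra.
pose D := Num.sqrt (A ^+ 2 - 4 * B).
have D2 : D ^+ 2 = A ^+ 2 - 4 * B by rewrite sqr_sqrtr// subr_ge0.
have D0 : 0 <= D by exact: sqrtr_ge0.
have DA : D < A by rewrite -ltr_sqr ?nnegrE// ?(ltW A0)// D2; lra.
(* The characteristic roots are [- r1] and [- r2]. *)
pose r1 := (A - D) / 2; pose r2 := (A + D) / 2.
have r10 : 0 < r1 by rewrite /r1; lra.
have r12 : r1 <= r2 by rewrite /r1 /r2; lra.
have EA : A = r1 + r2 by rewrite /r1 /r2; field.
have EB : B = r1 * r2.
  have -> : r1 * r2 = (A ^+ 2 - D ^+ 2) / 4 by rewrite /r1 /r2; field.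
  by rewrite D2; field.
(* The first bound on [l] gives [1 / (r1 - l) <= 2 / r1], whence the constant [3 + 2 / r1]. The
   second gives [(r2 - l) (r1 - l) >= B - l A >= m]. *)
exists (Num.min (r1 / 2) ((B - m) / A)), (3 + 2 / r1); split.
- by rewrite lt_min !divr_gt0//; lra.
- by rewrite addr_ge0// divr_ge0// ltW.
move=> l l0; rewrite le_min => /andP[lr1]; rewrite ler_pdivlMr// => lB.
move=> c T F u v f cT F0 sys Ff t ct tT.
have d1 : 0 < r1 - l by lra.
have d2 : 0 < r2 - l by lra.
have lr1' : l < r1 by lra.
have lr2' : l < r2 by lra.
rewrite EA EB in sys.
apply: (le_trans (overdamped_bound cT r10 lr1' lr2' F0 sys Ff ct tT)).
have inv1 : (r1 - l)^-1 <= 2 / r1.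
  by rewrite -[leRHS]invf_div lef_pV2 ?posrE ?divr_gt0//; lra.
have inv2 : F / (r2 - l) / (r1 - l) <= F / m.
  rewrite -mulrA -invfM; apply: ler_wpM2l => //.
  rewrite lef_pV2 ?posrE ?mulr_gt0//.
  have -> : (r2 - l) * (r1 - l) = B - l * A + l ^+ 2 by rewrite EA EB; ring.
  by have := sqr_ge0 l; lra.
have n1 := normr_ge0 (u c); have n2 := normr_ge0 (v c).
have s0 : 0 <= `|v c| + r1 * `|u c| by rewrite addr_ge0// mulr_ge0// ltW.
have := ler_wpM2l s0 inv1.
have -> : (`|v c| + r1 * `|u c|) * (2 / r1) = 2 / r1 * `|v c| + 2 * `|u c|.
  by field; rewrite gt_eqF.
have : 0 <= 2 / r1 * `|u c| by rewrite mulr_ge0// divr_ge0// ltW.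
rewrite [in X in _ -> _ -> X <= _]mulrDl; lra.
Qed.

Lemma underdamped_weighted_bound (R : realType) (A B m : R) :
  0 < A -> 0 < m -> A ^+ 2 < 4 * B ->
  m < A * Num.sqrt (4 * B - A ^+ 2) / 4 ->
  exists l0 C, [/\ 0 < l0, 0 <= C &
    forall l, 0 < l -> l <= l0 -> weighted_bound A B l C m].
Proof.
move=> A0 m0 AB mB.
(* The characteristic roots are [- A / 2] plus or minus [i w], and the threshold is [w * A / 2]. *)
pose w := Num.sqrt (4 * B - A ^+ 2) / 2.
have w0 : 0 < w by rewrite divr_gt0// sqrtr_gt0; lra.
have EB : B = w ^+ 2 + A ^+ 2 / 4.
  by rewrite exprMn sqr_sqrtr; [field|lra].
have mw : m < A / 2 * w by rewrite (_ : _ * w = A * Num.sqrt (4 * B - A ^+ 2) / 4)// /w; field.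
(* The first bound keeps [A / 2 - l] positive, the second gives [w (A / 2 - l) >= m]; the constant
   comes from dividing the energy bound by [w]. *)
exists (Num.min (A / 4) ((A / 2 * w - m) / w)), ((1 + A / 2 + w) / w); split.
- by rewrite lt_min; apply/andP; split; apply: divr_gt0 => //; rewrite subr_gt0.
- by rewrite divr_ge0//; lra.
move=> l l0; rewrite le_min => /andP[lA]; rewrite ler_pdivlMr// => lB.
move=> c T F u v f cT F0 sys Ff t ct tT.
have lA' : l < A / 2 by lra.
have d1 : 0 < A / 2 - l by lra.
rewrite EB in sys.
have H := underdamped_bound cT A0 w0 lA' F0 sys Ff ct tT.
have FF : F / (A / 2 - l) <= w * (F / m).
  rewrite ler_pdivrMr// (_ : w * (F / m) * (A / 2 - l) = F * (w * (A / 2 - l) / m)).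
    apply: ler_peMr => //; rewrite ler_pdivlMr// mul1r; lra.
  by field; rewrite gt_eqF.
have n1 := normr_ge0 (u c); have n2 := normr_ge0 (v c).
rewrite -(ler_pM2l w0) mulrDr.
have -> : w * ((1 + A / 2 + w) / w * (`|u c| + `|v c|)) =
   (1 + A / 2 + w) * (`|u c| + `|v c|) by field; rewrite gt_eqF.
have : 0 <= (A / 2 + w) * `|v c| by rewrite mulr_ge0//; lra.
lra.
Qed.

Lemma constant_coefficient_bound (R : realType) (A B m : R) :
  0 < A -> 0 < m -> m < stability_threshold A B ->
  exists l0 C, [/\ 0 < l0, 0 <= C &
    forall l, 0 < l -> l <= l0 -> weighted_bound A B l C m].
Proof.
move=> A0 m0; rewrite /stability_threshold; case: ifPn => h mB.
  exact: overdamped_weighted_bound.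
by apply: underdamped_weighted_bound; rewrite // ltNge.
Qed.

(** * Perturbation of the constant-coefficient equation *)

(** A bound [U] on [|u|] yields one on [|v|], then one on the right-hand side, and so the new bound
    [(C + da / m) N + q U] on [|u|]. Since [q < 1], taking [U] to be the supremum of [|u|] allows
    the last term to be absorbed. [K] is chosen before the coefficients, [c] and [T]. *)
Lemma perturbation_bound (R : realType) (A B l C m al be da db : R) :
  weighted_bound A B l C m -> 0 <= C -> 0 < m -> 0 < l -> l < al ->
  0 <= be -> 0 <= da -> 0 <= db -> da * (be * (al / (al - l))) + db < m ->
  exists2 K, 0 <= K &
  forall (a b u v : R -> R) (c T : R), c <= T ->
  abs_continuous_on c T u -> abs_continuous_on c T v ->
  {ae (@lebesgue_measure R), forall t, c < t -> t < T ->
     [/\ is_derive t (1 : R) u (l * u t + v t),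
         is_derive t (1 : R) v (- (a t - l) * v t - b t * u t), al <= a t &
         [/\ `|b t| <= be * a t, `|a t - A| <= da & `|b t - B| <= db]]} ->
  forall t, c <= t -> t <= T -> `|u t| <= K * (`|u c| + `|v c|).
Proof.
move=> wb C0 m0 l0 lal be0 da0 db0.
have d0 : 0 < al - l by lra.
set be' := be * (al / (al - l)) => qm.
have be'0 : 0 <= be' by rewrite mulr_ge0// divr_ge0//; lra.
pose q := (da * be' + db) / m.
have q1 : q < 1 by rewrite ltr_pdivrMr// mul1r.
have K0 : 0 <= C + da / m by rewrite addr_ge0// divr_ge0// ltW.
exists ((C + da / m) / (1 - q)); first by rewrite divr_ge0//; lra.
move=> a b u v c T cT acu acv ae t ct tT.
pose N := `|u c| + `|v c|.
have step U : 0 <= U -> (forall s, c <= s -> s <= T -> `|u s| <= U) ->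
    forall s, c <= s -> s <= T -> `|u s| <= (C + da / m) * N + q * U.
  move=> U0 uU.
  have vb : forall s, c <= s -> s <= T -> `|v s| <= `|v c| + be' * U.
    apply: (@first_order_bound _ v (fun s => a s - l) (fun s => - b s * u s)) => //.
      by rewrite mulr_ge0.
    apply: filterS ae => s H cs sT; have [du dv ala [bb _ _]] := H cs sT; split.
    - by move: dv; congr (is_derive _ _ _ _); ring.
    - lra.
    - rewrite normrM normrN mulrA; apply: ler_pM => //; last exact: uU (ltW cs) (ltW sT).
      (* As [a / (a - l)] decreases in [a], the lower bound [al <= a] turns [|b| <= be * a] into
         [|b| <= be' * (a - l)]. *)
      apply: (le_trans bb); rewrite /be' mulrCA; apply: ler_wpM2l => //.
      rewrite mulrA ler_pdivlMr//.
      have : l * (a s - al) >= 0 by rewrite mulr_ge0//; lra.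
      lra.
  pose F := da * (`|v c| + be' * U) + db * U.
  have F0 : 0 <= F by rewrite !addr_ge0 ?mulr_ge0// addr_ge0// mulr_ge0.
  have sys : weighted_system A B l c T u v (fun s => (A - a s) * v s + (B - b s) * u s).
    split => //; apply: filterS ae => s H cs sT; have [du dv _ _] := H cs sT.
    by split => //; move: dv; congr (is_derive _ _ _ _); ring.
  move=> s cs sT; apply: (le_trans (wb _ _ F _ _ _ cT F0 sys _ s cs sT)).
    apply: filterS ae => r H cr rT; have [_ _ _ [_ ha hb]] := H cr rT.
    rewrite (le_trans (ler_normD _ _))// !normrM lerD// ler_pM//.
    - by rewrite distrC.
    - exact: vb (ltW cr) (ltW rT).
    - by rewrite distrC.
    - exact: uU (ltW cr) (ltW rT).
  have -> : F / m = da / m * `|v c| + q * U by rewrite /F /q; field; rewrite gt_eqF.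
  have : 0 <= da / m * `|u c| by rewrite mulr_ge0// divr_ge0// ltW.
  rewrite /N; lra.
(* The supremum has to be finite before [q * sup S] can be moved to the other side. *)
have [M0 M00 uM0] := ac_bounded cT acu.
pose S := [set `|u s| | s in [set s | c <= s /\ s <= T]].
have Sub : has_ubound S by exists M0 => _ [s [cs sT] <-]; exact: uM0.
have Sne : S !=set0 by exists `|u c|; exists c.
have uS s : c <= s -> s <= T -> `|u s| <= sup S.
  by move=> cs sT; apply: ub_le_sup => //; exists s.
have S0 : 0 <= sup S by apply: le_trans (uS c (lexx _) cT).
have : sup S <= (C + da / m) * N + q * sup S.
  by apply: ge_sup => // _ [s [cs sT] <-]; exact: step.
move=> SS; apply: (le_trans (uS t ct tT)).
rewrite mulrAC ler_pdivlMr ?subr_gt0// -/N; lra.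
Qed.

(** * Regularity, growth and decay of solutions *)

(** Locally the increments from [t] are at most [(L + 1) |u - t|], and [cousin] makes this a
    Lipschitz bound. Only points [u] of the interval are tested, so one-sided derivatives at its
    ends suffice, as for a solution at its starting time. *)
Lemma ac_of_bounded_derivative (R : realType) (g dg : R -> R) (c T L : R) :
  (forall t, c <= t -> t <= T -> `|dg t| <= L) ->
  (forall t, c <= t -> t <= T -> exists2 r, 0 < r &
     forall u, c <= u -> u <= T -> `|u - t| < r ->
       `|g u - g t - dg t * (u - t)| <= `|u - t|) ->
  abs_continuous_on c T g.
Proof.
move=> dgL H; apply: (@ac_lipschitz _ _ _ (L + 1)) => p q cp pq qT.
apply: (cousin (P := fun p q => `|g q - g p| <= (L + 1) * (q - p))) => //.
- move=> x y z px xy yz zq h1 h2.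
  rewrite -(subrKA (g y)) (le_trans (ler_normD _ _))//; lra.
- move=> t pt tq; have ct := le_trans cp pt; have tT := le_trans tq qT.
  have [r r0 Hr] := H t ct tT; have L1 := dgL t ct tT; exists r => //.
  have near_t u : c <= u -> u <= T -> `|u - t| < r ->
      `|g u - g t| <= (L + 1) * `|u - t|.
    move=> cu uT ur; have := Hr u cu uT ur.
    have := ler_normD (g u - g t - dg t * (u - t)) (dg t * (u - t)).
    rewrite subrK normrM.
    have := ler_wpM2r (normr_ge0 (u - t)) L1; lra.
  move=> x y px xt ty yq h1 h2.
  rewrite -(subrKA (g t)) (le_trans (ler_normD _ _))//.
  have yr : `|y - t| < r by rewrite ger0_norm; lra.
  have xr : `|x - t| < r by rewrite ler0_norm; lra.
  have := near_t y (le_trans ct ty) (le_trans yq qT) yr.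
  have := near_t x (le_trans cp px) (le_trans xt tT) xr.
  rewrite (ger0_norm (_ : 0 <= y - t)) ?subr_ge0//.
  rewrite (ler0_norm (_ : x - t <= 0)) ?subr_le0//.
  rewrite [`|g t - g x|]distrC; lra.
Qed.

Lemma ac_expR_affine (R : realType) (l k c T : R) :
  abs_continuous_on c T (fun t => expR (l * (t - k))).
Proof.
apply: (@ac_of_bounded_derivative _ _ (fun t => l * expR (l * (t - k))) _ _
  (`|l| * expR (`|l| * (`|c - k| + `|T - k|)))).
- move=> t ct tT; rewrite normrM (ger0_norm (expR_ge0 _)) ler_wpM2l// ler_expR.
  rewrite (le_trans (ler_norm _))// normrM ler_wpM2l//.
  have [h|h] := leP k t.
    rewrite ger0_norm ?subr_ge0//.
    by have := ler_norm (T - k); have := normr_ge0 (c - k); lra.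
  rewrite ltr0_norm ?subr_lt0//.
  by have := ler_norm (k - c); rewrite distrC; have := normr_ge0 (T - k); lra.
- move=> t ct tT.
  have [r r0 H] := is_derive_remainder (is_derive_expR_affine t l k) ltr01.
  by exists r => // u _ _ /H; rewrite mul1r.
Qed.

Section Solutions.
Variables (R : realType) (a b : R -> R) (s : R) (x dx : R -> R).
Hypothesis sol : is_solution a b s x dx.

Lemma solution_remainder (t e : R) : s <= t -> 0 < e -> exists2 r, 0 < r &
  forall u, s <= u -> `|u - t| < r ->
    `|x u - x t - dx t * (u - t)| <= e * `|u - t|.
Proof.
move=> st e0; have [h _ _] := sol.
have := h t st => /cvgrPdist_le /(_ e e0).
rewrite near_withinE near_withinE => -[r /= r0 H].
exists r => // u su ur; have [->|nut] := eqVneq u t.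
  by rewrite !subrr mulr0 subrr normr0 mulr0.
have := H u; rewrite /ball_ /= distrC => /(_ ur nut).
rewrite in_itv /= andbT => /(_ su) K.
have n0 : 0 < `|u - t| by rewrite normr_gt0 subr_eq0.
have -> : x u - x t - dx t * (u - t) = - ((dx t - (x u - x t) / (u - t)) * (u - t)).
  by field; rewrite subr_eq0.
by rewrite normrN normrM ler_pM2r.
Qed.

Lemma solution_is_derive (t : R) : s < t -> is_derive t (1 : R) x (dx t).
Proof.
move=> st.
have lim : (fun h : R => h^-1 *: (x (h *: (1 : R) + t) - x t)) @ 0^' --> dx t.
  apply/cvgrPdist_le => e e0.
  have [r r0 H] := solution_remainder (ltW st) e0.
  (* The cap [t - s] keeps [h + t] in the half-line on which the solution is differentiable. *)
  rewrite near_withinE; exists (Num.min r (t - s)) => /=.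
    by rewrite lt_min r0 subr_gt0.
  move=> h; rewrite /= sub0r normrN lt_min => /andP[hr hs] h0.
  have sh : s <= h + t.
    by move: hs; rewrite ltr_norml => /andP[]; lra.
  rewrite /GRing.scale /= mulr1; have := H (h + t) sh; rewrite addrK => /(_ hr).
  have -> : x (h + t) - x t - dx t * h = - ((dx t - h^-1 * (x (h + t) - x t)) * h).
    by field.
  by rewrite normrN normrM ler_pM2r ?normr_gt0.
by split; [apply/cvg_ex; exists (dx t)|exact: cvg_lim lim].
Qed.

Lemma solution_ac (c T : R) : s <= c -> c <= T ->
  abs_continuous_on c T x /\ abs_continuous_on c T dx.
Proof.
move=> sc cT; have [_ h _] := sol.
have acdx : abs_continuous_on c T dx by exact: acW (h T (le_trans sc cT)).
split => //; have [L L0 HL] := ac_bounded cT acdx.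
apply: ac_of_bounded_derivative HL _ => t ct tT.
have [r r0 H] := solution_remainder (le_trans sc ct) ltr01.
by exists r => // u cu _ /(H _ (le_trans sc cu)); rewrite mul1r.
Qed.

Lemma solution_ae_derive : {ae (@lebesgue_measure R), forall t, s < t ->
  is_derive t (1 : R) x (dx t) /\
  is_derive t (1 : R) dx (- a t * dx t - b t * x t)}.
Proof.
have [_ _ h] := sol; apply: filterS h => t H st; have [d1 d2] := H st.
split; first exact: solution_is_derive.
apply: DeriveDef => //; lra.
Qed.

(** The energy [x ^+ 2 + dx ^+ 2], weighted by the decaying exponential, is nonincreasing: [a >= 0]
    only dissipates, and the cross term [2 (1 - b) x dx] is at most [(1 + bM)] times the energy.
    This serves before [t0], where the coefficients need not be close to [A] and [B]. *)
Lemma solution_growth (bM t : R) : 0 <= bM -> s <= t ->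
  {ae (@lebesgue_measure R), forall r, s < r -> 0 <= a r /\ `|b r| <= bM} ->
  x t ^+ 2 + dx t ^+ 2 <= expR ((1 + bM) * (t - s)) * (x s ^+ 2 + dx s ^+ 2).
Proof.
move=> bM0 st aeab; pose L := 1 + bM.
pose E r := expR (- L * (r - s)) * (x r * x r + dx r * dx r).
have [acx acdx] := solution_ac (lexx s) st.
have acE : abs_continuous_on s t E.
  apply: acM => //; first exact: ac_expR_affine.
  by apply: acD => //; apply: acM.
have : E t <= E s.
  apply: (ac_ae_nonincreasing st acE).
  apply: filterS2 solution_ae_derive aeab => r H Hab sr rt.
  have [d1 d2] := H sr; have [a0 bb] := Hab sr.
  have dE := is_derive_fun_mul (is_derive_expR_affine r (- L) s)
    (is_derive_fun_add (is_derive_fun_mul d1 d1) (is_derive_fun_mul d2 d2)).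
  eexists; first exact: dE.
  set y := dx r; set X := x r; set e := expR _.
  have -> : - L * e * (X * X + y * y) +
    e * (y * X + X * y + ((- a r * y - b r * X) * y + y * (- a r * y - b r * X))) =
    - (e * (L * (X * X + y * y) - 2 * (1 - b r) * (X * y) + 2 * (a r * (y * y)))) by ring.
  rewrite oppr_le0 mulr_ge0 ?expR_ge0//.
  have ay : 0 <= a r * (y * y) by rewrite mulr_ge0// -expr2 sqr_ge0.
  have : (1 - b r) * (X * y) <= L * (`|X| * `|y|).
    rewrite (le_trans (ler_norm _))// !normrM ler_wpM2r ?mulr_ge0//.
    by rewrite (le_trans (ler_normB _ _))// normr1 /L lerD2l.
  have : 0 <= L * (`|X| - `|y|) ^+ 2 by rewrite mulr_ge0 ?sqr_ge0// /L; lra.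
  have -> : X * X + y * y = `|X| ^+ 2 + `|y| ^+ 2 by rewrite !real_normK ?num_real.
  lra.
rewrite /E subrr mulr0 expR0 mul1r !expr2 -/L => H.
rewrite -ler_pdivrMl ?expR_gt0// -expRN.
by move: H; rewrite mulNr.
Qed.

(** Multiplication by [e^{l(r-c)}] turns [x] and [dx] into such a pair [u], [v]; the weight is 1 at
    [c], and dividing by its value at [t] gives the decay. *)
Lemma solution_decay (l K c t : R) : s <= c -> c <= t ->
  (forall u v : R -> R, abs_continuous_on c t u -> abs_continuous_on c t v ->
    {ae (@lebesgue_measure R), forall r, c < r -> r < t ->
      is_derive r (1 : R) u (l * u r + v r) /\
      is_derive r (1 : R) v (- (a r - l) * v r - b r * u r)} ->
    `|u t| <= K * (`|u c| + `|v c|)) ->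
  `|x t| <= K * (`|x c| + `|dx c|) * expR (- l * (t - c)).
Proof.
move=> sc ct H.
have [acx acdx] := solution_ac sc ct.
have ace := ac_expR_affine l c c t.
have := H _ _ (acM ct ace acx) (acM ct ace acdx).
rewrite subrr mulr0 expR0 !mul1r normrM (ger0_norm (expR_ge0 _)) => h.
rewrite mulNr expRN ler_pdivlMr ?expR_gt0// mulrC; apply: h.
apply: filterS solution_ae_derive => r Hr cr rt.
have [d1 d2] := Hr (le_lt_trans sc cr).
have de := is_derive_expR_affine r l c.
split.
  by have := is_derive_fun_mul de d1; congr (is_derive _ _ _ _); ring.
by have := is_derive_fun_mul de d2; congr (is_derive _ _ _ _); ring.
Qed.

End Solutions.

(** * The essential supremum norm as an a.e. bound *)

Section LinfNorm.
Variables (R : realType) (t0 : R).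
Implicit Type f : R -> R.

Let lebesgue_setT_gt0 :
  (0 < @lebesgue_measure R [set: measurableTypeR R])%E.
Proof. by rewrite -set_itvE lebesgue_measure_itv /= ltry. Qed.

Lemma Linf_norm_leP f (M : R) : 0 <= M ->
  (Linf_norm `[t0, +oo[ f <= M%:E)%E <->
  {ae (@lebesgue_measure R), forall t, t0 <= t -> `|f t| <= M}.
Proof.
(* At exponent [+oo] the norm is the essential supremum because the whole line has positive
   measure. *)
move=> M0; rewrite /Linf_norm unlock lebesgue_setT_gt0.
split.
  move/ess_sup_inf.ess_supP; apply: filterS => t /=.
  by rewrite patchE mem_setE in_itv /= andbT => + t0t; rewrite t0t lee_fin.
move=> h; apply/ess_sup_inf.ess_supP; move: h; apply: filterS => t h /=.
rewrite patchE mem_setE in_itv /= andbT lee_fin.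
(* Outside the half-line the extended function is 0, and the bound there is [0 <= M]. *)
by case: ifPn => [/h//|_]; rewrite normr0.
Qed.

Lemma Linf_norm_fine f : (Linf_norm `[t0, +oo[ f < +oo)%E ->
  0 <= fine (Linf_norm `[t0, +oo[ f) /\
  {ae (@lebesgue_measure R), forall t, t0 <= t ->
    `|f t| <= fine (Linf_norm `[t0, +oo[ f)}.
Proof.
move=> foo; have f0 : (0 <= Linf_norm `[t0, +oo[ f)%E by exact: Lnorm_ge0.
have h : 0 <= fine (Linf_norm `[t0, +oo[ f) by exact: fine_ge0.
split => //; apply/(Linf_norm_leP _ h).
by rewrite fineK// ge0_fin_numE.
Qed.

Lemma Linf_norm_fin f (M : R) : 0 <= M ->
  {ae (@lebesgue_measure R), forall t, t0 <= t -> `|f t| <= M} ->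
  (Linf_norm `[t0, +oo[ f < +oo)%E.
Proof. by move=> M0 /(Linf_norm_leP _ M0)/le_lt_trans; apply; exact: ltry. Qed.

Lemma Linf_normE f : (Linf_norm `[t0, +oo[ f < +oo)%E ->
  Linf_norm `[t0, +oo[ f = (fine (Linf_norm `[t0, +oo[ f))%:E.
Proof. by move=> foo; rewrite fineK// ge0_fin_numE//; exact: Lnorm_ge0. Qed.

End LinfNorm.

(** * Decay of the fundamental function and conclusion *)

(** The factor [al / (al - l)], the cost of replacing [a] by [a - l] in [b / a], tends to 1 as [l]
    tends to 0. *)
Lemma small_decay_rate (R : realType) (al l0 p g : R) :
  0 < al -> 0 < l0 -> 0 <= p -> 0 < g ->
  exists l, [/\ 0 < l, l <= l0, l < al & p * (al / (al - l)) < p + g].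
Proof.
move=> al0 l00 p0 g0.
(* The claim amounts to [(p + g) l < g al]: the last two bounds give [g l <= g al / 2] and
   [p l <= g al / 4]. *)
pose l := Num.min l0 (Num.min (al / 2) (al * g / (4 * (p + 1)))).
have ll0 : 0 < l.
  by rewrite /l !lt_min l00 !divr_gt0// ?mulr_gt0//; lra.
have [h1 [h2 h3]] : l <= l0 /\ l <= al / 2 /\ l <= al * g / (4 * (p + 1)).
  by rewrite /l !ge_min !lexx !orbT.
exists l; split => //; first lra.
have d : 0 < al - l by lra.
rewrite mulrA ltr_pdivrMr//.
move: h3; rewrite ler_pdivlMr; last lra.
have : 0 <= g * (al / 2 - l) by rewrite mulr_ge0; lra.
have : 0 < g * al by rewrite mulr_gt0.
have : 0 <= l * p by rewrite mulr_ge0// ltW.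
lra.
Qed.

(** Decay is started at the later of [s] and [t0]. On [[s, t0]] the growth estimate gives a bound
    independent of [s], and the decay missed there is made up for by a constant factor. *)
Lemma fundamental_function_decay (R : realType) (a b : R -> R)
    (A B al t0 da be db bM : R) :
  0 < A -> 0 <= t0 -> 0 < al ->
  0 <= da -> 0 <= be -> 0 <= db -> 0 <= bM ->
  {ae (@lebesgue_measure R), forall t, 0 <= t -> al <= a t /\ `|b t| <= bM} ->
  {ae (@lebesgue_measure R), forall t, t0 <= t ->
    [/\ `|a t - A| <= da, `|b t / a t| <= be & `|b t - B| <= db]} ->
  da * be + db < stability_threshold A B ->
  exponentially_stable a b.
Proof.
move=> A0 t00 al0 da0 be0 db0 bM0 aeab aedev small X fX.
pose k := da * be + db.
have k0 : 0 <= k by rewrite addr_ge0// mulr_ge0.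
(* The midpoint leaves room on both sides: below the threshold for the weight in the
   constant-coefficient bound, above [k] for passing from [b / a] to [b / (a - l)]. *)
pose m := (k + stability_threshold A B) / 2.
have km : k < m by rewrite /m /k; lra.
have mt : m < stability_threshold A B by rewrite /m /k; lra.
have m0 : 0 < m by lra.
have [l0 [C [l00 C0 wb]]] := constant_coefficient_bound A0 m0 mt.
have p0 : 0 <= da * be by rewrite mulr_ge0.
have g0 : 0 < m - k by lra.
have [l [lp ll0 lal hl]] := small_decay_rate al0 l00 p0 g0.
have hq : da * (be * (al / (al - l))) + db < m.
  by rewrite mulrA; move: hl; rewrite /k; lra.
have [K K0 HK] := perturbation_bound (wb l lp ll0) C0 m0 lp lal be0 da0 db0 hq.
have decay s c t dx : 0 <= s -> is_solution a b s (X^~ s) dx ->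
    s <= c -> t0 <= c -> c <= t ->
    `|X t s| <= K * (`|X c s| + `|dx c|) * expR (- l * (t - c)).
  move=> s0 sol sc t0c ct; apply: (solution_decay sol) => // u v acu acv aeuv.
  apply: (HK a b u v c t ct acu acv _ t ct (lexx t)).
  apply: filterS3 aeuv aeab aedev => r H Hab Hdev cr rt.
  have [d1 d2] := H cr rt.
  have [ala _] := Hab (le_trans t00 (le_trans t0c (ltW cr))).
  have [h1 h2 h3] := Hdev (le_trans t0c (ltW cr)).
  have ar : 0 < a r by lra.
  split => //; split => //.
  by move: h2; rewrite normrM normfV (gtr0_norm ar) ler_pdivrMr.
pose N := expR ((1 + bM) * t0).
have N1 : 1 <= N by rewrite -expR0 ler_expR mulr_ge0//; lra.
have early s c dx : 0 <= s -> is_solution a b s (X^~ s) dx -> X s s = 0 ->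
    dx s = 1 -> s <= c -> c <= t0 -> `|X c s| <= N /\ `|dx c| <= N.
  move=> s0 sol xs dxs sc ct0.
  have aes : {ae (@lebesgue_measure R), forall r, s < r -> 0 <= a r /\ `|b r| <= bM}.
    apply: filterS aeab => r H sr; have [ar br] := H (le_trans s0 (ltW sr)).
    by split => //; lra.
  have := solution_growth sol bM0 sc aes.
  rewrite xs dxs expr0n /= add0r expr1n mulr1 => growth.
  have gN : X c s ^+ 2 + dx c ^+ 2 <= N.
    apply: (le_trans growth); rewrite ler_expR ler_wpM2l//; lra.
  (* The energy starts at 1 and stays at most [N]; as [N >= 1], each component is at most [N]
     itself. *)
  have NN : N <= N ^+ 2 by rewrite expr2 ler_peMr//; lra.
  have N0 : 0 <= N by lra.
  split; rewrite -ler_sqr ?nnegrE// real_normK ?num_real//.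
    by have := sqr_ge0 (dx c); lra.
  by have := sqr_ge0 (X c s); lra.
pose e0 := expR (l * t0).
have e01 : 1 <= e0 by rewrite -expR0 ler_expR mulr_ge0// ltW.
have Kpos : 0 < (2 * K + 1) * N * e0 by rewrite !mulr_gt0//; lra.
(* [2 * K * N] bounds the decay started at [t0] from two components of size [N]; the summand 1
   covers times up to [t0], and [e0] pays for the shift from [s] to [t0]. *)
exists ((2 * K + 1) * N * e0), l; split => // t s s0 st.
have [dx [sol xs dxs]] := fX s s0.
have shift : expR (- l * (t - s)) * e0 >= expR (- l * (t - t0)).
  rewrite -expRD ler_expR.
  have : 0 <= l * s by rewrite mulr_ge0// ltW.
  lra.
have NK : 0 <= K * N by rewrite mulr_ge0//; lra.
have [t0s|st0] := leP t0 s.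
  have := decay s s t dx s0 sol (lexx s) t0s st.
  rewrite xs dxs normr0 normr1 add0r mulr1 => h; apply: (le_trans h).
  apply: ler_wpM2r; first exact: expR_ge0.
  have : K <= K * N by rewrite ler_peMr.
  have : (2 * K + 1) * N <= (2 * K + 1) * N * e0 by rewrite ler_peMr// mulr_ge0//; lra.
  lra.
rewrite [leRHS]mulrAC -[leRHS]mulrA.
have [tt0|t0t] := leP t t0.
  have [h _] := early s t dx s0 sol xs dxs st tt0; apply: (le_trans h).
  have : 1 <= expR (- l * (t - t0)).
    rewrite -expR0 ler_expR mulNr -mulrN mulr_ge0//; lra.
  move=> /le_trans/(_ shift) h1.
  apply: (@le_trans _ _ ((2 * K + 1) * N)); first lra.
  by rewrite ler_peMr//; lra.
have [h1 h2] := early s t0 dx s0 sol xs dxs (ltW st0) (lexx t0).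
have := decay s t0 t dx s0 sol (ltW st0) (lexx t0) (ltW t0t).
move=> h; apply: (le_trans h); apply: ler_pM => //.
- by rewrite mulr_ge0// addr_ge0.
- have : K * (`|X t0 s| + `|dx t0|) <= K * (2 * N) by rewrite ler_wpM2l//; lra.
  lra.
Qed.

Theorem theorem8 (R : realType) (a b : R -> R) (alpha : R)
  (ma : lebesgue_measurable_fun `[0, +oo[ a)
  (mb : lebesgue_measurable_fun `[0, +oo[ b)
  (a_bounded : (Linf_norm `[0%R, +oo[ a < +oo)%E)
  (b_bounded : (Linf_norm `[0%R, +oo[ b < +oo)%E)
  (alpha_gt0 : 0 < alpha)
  (a_ge : {ae (@lebesgue_measure R), forall t, 0 <= t -> alpha <= a t})
  (b_ge0 : {ae (@lebesgue_measure R), forall t, 0 <= t -> 0 <= b t})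
  (hAB : exists A B t0 : R, [/\ 0 < A, 0 < B, 0 <= t0 &
    (Linf_norm `[t0, +oo[ (fun t => (a t - A)%R)
       * Linf_norm `[t0, +oo[ (fun t => (b t / a t)%R)
     + Linf_norm `[t0, +oo[ (fun t => (b t - B)%R)
     < (if (4 * B <= A ^+ 2)%R then B
        else (A * Num.sqrt (4 * B - A ^+ 2) / 4)%R)%:E)%E]) :
  exponentially_stable a b.
Proof.
have [A [B [t0 [A0 B0 t00 small]]]] := hAB.
have [aM0 aeaM] := Linf_norm_fine a_bounded.
have [bM0 aebM] := Linf_norm_fine b_bounded.
set aM := fine _ in aM0 aeaM; set bM := fine _ in bM0 aebM.
(* Finiteness of the three norms turns the extended-real hypothesis into an inequality of reals; for
   the quotient it comes from [a >= alpha]. *)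
have fin_a : (Linf_norm `[t0, +oo[ (fun t => a t - A)%R < +oo)%E.
  apply: (@Linf_norm_fin _ _ _ (aM + A)); first by rewrite addr_ge0// ltW.
  apply: filterS aeaM => t H t0t; rewrite (le_trans (ler_normB _ _))//.
  by rewrite (gtr0_norm A0) lerD2r; apply: H; exact: le_trans t0t.
have fin_b : (Linf_norm `[t0, +oo[ (fun t => b t - B)%R < +oo)%E.
  apply: (@Linf_norm_fin _ _ _ (bM + B)); first by rewrite addr_ge0// ltW.
  apply: filterS aebM => t H t0t; rewrite (le_trans (ler_normB _ _))//.
  by rewrite (gtr0_norm B0) lerD2r; apply: H; exact: le_trans t0t.
have fin_q : (Linf_norm `[t0, +oo[ (fun t => b t / a t)%R < +oo)%E.
  apply: (@Linf_norm_fin _ _ _ (bM / alpha)); first by rewrite divr_ge0// ltW.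
  apply: filterS2 aebM a_ge => t Hb Ha t0t.
  have t_ge0 := le_trans t00 t0t; have at0 := lt_le_trans alpha_gt0 (Ha t_ge0).
  rewrite normrM normfV (gtr0_norm at0) ler_pM ?invr_ge0 ?(ltW at0)//.
    exact: Hb.
  by rewrite lef_pV2 ?posrE//; exact: Ha.
have [da0 aeda] := Linf_norm_fine fin_a.
have [db0 aedb] := Linf_norm_fine fin_b.
have [be0 aebe] := Linf_norm_fine fin_q.
apply: (fundamental_function_decay A0 t00 alpha_gt0 da0 be0 db0 bM0).
- by apply: filterS2 aebM a_ge => t Hb Ha t_ge0; split; [exact: Ha|exact: Hb].
- apply: filterS3 aeda aebe aedb => t H1 H2 H3 t0t.
  by split; [exact: H1|exact: H2|exact: H3].
- move: small; rewrite (Linf_normE fin_a) (Linf_normE fin_b) (Linf_normE fin_q).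
  by rewrite -EFinM -EFinD lte_fin.
Qed.
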